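(* For all integers $d,s$ with $2 \le d \le s$, $$R_{D}(s,s,d) \le 2\left[\frac{d}{2}\right] R\left(\left\lceil \frac{s}{[d/2]} \right\rceil, \left\lceil \frac{s}{[d/2]} \right\rceil\right).$$ Moreover, for fixed $d\ge 2$ and $s\to\infty$, $$2\left[\frac{d}{2}\right] R\left(\left\lceil \frac{s}{[d/2]} \right\rceil, \left\lceil \frac{s}{[d/2]} \right\rceil\right) \le 4^{\frac{s}{[d/2]}(1+o(1))}.$$
   Context: $[x]$ denotes the integer part of $x$. A graph $G$ is a (unit) distance graph in $\mathbb{R}^d$ if $V(G) \subseteq \mathbb{R}^d$ and $E(G) \subseteq \{\{x,y\} : x,y\in V(G),\ |x-y|=1\}$ (not all unit-distance pairs need be edges). The distance Ramsey number $R_{D}(s,t,d)$ is the minimum natural number $n$ such that for any graph $G$ on $n$ vertices, either $G$ contains an induced $s$-vertex subgraph isomorphic to a distance graph in $\mathbb{R}^d$, or the complement $\bar G$ contains an induced $t$-vertex subgraph isomorphic to a distance graph in $\mathbb{R}^d$. The classical Ramsey number $R(s,t)$ is the minimum natural number $n$ such that for any graph $G$ on $n$ vertices, either $G$ contains an independent set of size $s$ or $\bar G$ contains an independent set of size $t$. *)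

(* Defs.v *)
From mathcomp Require Import all_boot all_order all_algebra.
From mathcomp Require Import all_classical all_reals all_analysis.

Set Implicit Arguments.
Unset Strict Implicit.
Unset Printing Implicit Defensive.

Import Order.TTheory GRing.Theory Num.Theory.
Import numFieldNormedType.Exports.

Local Open Scope ring_scope.
Local Open Scope nat_scope.

Record sgraph (T : Type) := SGraph {
  adj :> rel T;
  adj_sym : symmetric adj;
  adj_irr : irreflexive adj }.

Lemma compl_sym (T : eqType) (G : sgraph T) :
  symmetric [rel x y | (x != y) && ~~ G x y].
Proof. by move=> x y /=; rewrite eq_sym adj_sym. Qed.

Lemma compl_irr (T : eqType) (G : sgraph T) :
  irreflexive [rel x y | (x != y) && ~~ G x y].
Proof. by move=> x /=; rewrite eqxx. Qed.

Definition graph_compl (T : eqType) (G : sgraph T) : sgraph T :=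
  SGraph (compl_sym G) (compl_irr G).

Lemma induced_sym (T : finType) (G : sgraph T) (A : {set T}) :
  symmetric (fun x y : {x | x \in A} => G (val x) (val y)).
Proof. by move=> x y; rewrite adj_sym. Qed.

Lemma induced_irr (T : finType) (G : sgraph T) (A : {set T}) :
  irreflexive (fun x y : {x | x \in A} => G (val x) (val y)).
Proof. by move=> x; rewrite adj_irr. Qed.

Definition induced (T : finType) (G : sgraph T) (A : {set T}) :
    sgraph {x | x \in A} :=
  SGraph (@induced_sym T G A) (@induced_irr T G A).

Definition isomorphic (T U : Type) (G : sgraph T) (H : sgraph U) : Prop :=
  exists2 f : T -> U, bijective f & forall x y, H (f x) (f y) = G x y.

(* The norm that the library puts on 'rV[R]_d is the sup norm, so the
   Euclidean distance has to be spelled out. *)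
Definition eucl_dist (R : realType) (d : nat) (x y : 'rV[R]_d) : R :=
  Num.sqrt (\sum_(i < d) (x ord0 i - y ord0 i) ^+ 2)%R.

(* Only one implication: points at distance 1 need not be adjacent. *)
Definition distance_graph (R : realType) (d : nat) (V : set 'rV[R]_d)
    (H : sgraph (set_type V)) : Prop :=
  forall x y, H x y -> eucl_dist (val x) (val y) = 1%R.

Definition has_distance_subgraph (R : realType) (T : finType) (G : sgraph T)
    (s d : nat) : Prop :=
  exists2 A : {set T}, #|A| = s &
    exists (V : set 'rV[R]_d) (H : sgraph (set_type V)),
      distance_graph H /\ isomorphic (induced G A) H.

Definition independent (T : finType) (G : sgraph T) (A : {set T}) : Prop :=
  forall x y, x \in A -> y \in A -> ~~ G x y.

Definition has_independent (T : finType) (G : sgraph T) (s : nat) : Prop :=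
  exists2 A : {set T}, #|A| = s & independent G A.

(* The default value 0, for an unsatisfiable P, does not occur for ramsey nor,
   in dimension d > 0, for dist_ramsey: see ramseyP and dist_ramseyP. *)
Definition least (P : nat -> Prop) : nat :=
  if pselect (exists n, `[< P n >]) is left h then ex_minn h else 0.

Definition ramsey_prop (s t n : nat) : Prop :=
  forall G : sgraph 'I_n, has_independent G s \/ has_independent (graph_compl G) t.

Definition ramsey (s t : nat) : nat := least (ramsey_prop s t).

Definition dist_ramsey_prop (R : realType) (s t d n : nat) : Prop :=
  forall G : sgraph 'I_n,
    has_distance_subgraph R G s d \/ has_distance_subgraph R (graph_compl G) t d.

Definition dist_ramsey (R : realType) (s t d : nat) : nat :=
  least (dist_ramsey_prop R s t d).

Definition ceil_div (m k : nat) : nat := `|Num.ceil (m%:R / k%:R : rat)%R|%N.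

Lemma leastP (P : nat -> Prop) : (exists n, P n) ->
  P (least P) /\ forall m, P m -> least P <= m.
Proof.
move=> [n Pn]; rewrite /least; case: pselect => [h|[]]; last first.
  by exists n; apply/asboolP.
case: ex_minnP => m /asboolP Pm min_m; split=> // k Pk.
by apply: min_m; apply/asboolP.
Qed.

Lemma ramsey_exists_aux s t : exists n,
  forall (T : finType) (G : sgraph T) (B : {set T}), n <= #|B| ->
    (exists2 A : {set T}, A \subset B & #|A| = s /\ independent G A) \/
    (exists2 A : {set T}, A \subset B & #|A| = t /\ independent (graph_compl G) A).
Proof.
elim: s t => [|s IHs] t.
  exists 0 => T G B _; left; exists finset.set0; first exact: finset.sub0set.
  by split=> [|x y]; rewrite ?cards0 ?inE.
elim: t => [|t [n2 IH2]].
  exists 0 => T G B _; right; exists finset.set0; first exact: finset.sub0set.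
  by split=> [|x y]; rewrite ?cards0 ?inE.
have [n1 IH1] := IHs t.+1; exists (n1 + n2).+1 => T G B leB.
have /card_gt0P[v vB] : 0 < #|B| by apply: leq_ltn_trans leB.
pose N : {set T} := [set x | G v x]%SET; pose C := B :\ v.
have CB : C \subset B by rewrite subD1set.
have cardC : n1 + n2 <= #|C :&: N| + #|C :\: N|.
  by rewrite cardsID -ltnS; move: leB; rewrite (cardsD1 v B) vB.
have [le2|lt2] := leqP n2 #|C :&: N|.
  have subB : C :&: N \subset B by apply: fintype.subset_trans CB; rewrite finset.subsetIl.
  have [[A sA [cA iA]]|[A sA [cA iA]]] := IH2 T G (C :&: N) le2.
    by left; exists A => //; apply: fintype.subset_trans sA subB.
  right; exists (v |: A).
    by rewrite finset.subUset finset.sub1set vB; apply: fintype.subset_trans sA subB.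
  have vA x : x \in A -> (x != v) && G v x.
    by move=> /(fintype.subsetP sA); rewrite !inE => /andP[/andP[-> _] ->].
  split.
    rewrite cardsU1 cA; case: (boolP (v \in A)) => // /vA.
    by rewrite eqxx.
  move=> x y; rewrite !in_setU1 => /orP[/eqP->|xA] /orP[/eqP->|yA] /=.
  - by rewrite eqxx.
  - by have /andP[_ ->] := vA _ yA; rewrite andbF.
  - by have /andP[_ Gx] := vA _ xA; rewrite adj_sym Gx andbF.
  - exact: iA.
have le1 : n1 <= #|C :\: N|.
  by rewrite -(leq_add2r n2) (leq_trans cardC) // addnC leq_add2l ltnW.
have subB : C :\: N \subset B by apply: fintype.subset_trans CB; rewrite finset.subsetDl.
have [[A sA [cA iA]]|[A sA [cA iA]]] := IH1 T G (C :\: N) le1; last first.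
  by right; exists A => //; apply: fintype.subset_trans sA subB.
left; exists (v |: A).
  by rewrite finset.subUset finset.sub1set vB; apply: fintype.subset_trans sA subB.
have vA x : x \in A -> (x != v) && ~~ G v x.
  by move=> /(fintype.subsetP sA); rewrite !inE => /andP[-> /andP[-> _]].
split.
  rewrite cardsU1 cA; case: (boolP (v \in A)) => // /vA.
  by rewrite eqxx.
move=> x y; rewrite !in_setU1 => /orP[/eqP->|xA] /orP[/eqP->|yA] /=.
- by rewrite adj_irr.
- by have /andP[_ ->] := vA _ yA.
- by have /andP[_ Gx] := vA _ xA; rewrite adj_sym.
- exact: iA.
Qed.

Lemma ramsey_exists s t : exists n, ramsey_prop s t n.
Proof.
have [n IH] := ramsey_exists_aux s t; exists n => G.
have le_n : n <= #|[set: 'I_n]%SET| by rewrite cardsT card_ord.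
have [[A _ [cA iA]]|[A _ [cA iA]]] := IH _ G _ le_n.
  by left; exists A.
by right; exists A.
Qed.

Lemma ramseyP s t : ramsey_prop s t (ramsey s t) /\
  forall m, ramsey_prop s t m -> ramsey s t <= m.
Proof. exact/leastP/ramsey_exists. Qed.

Lemma independent_distance (R : realType) (T : finType) (G : sgraph T) s d :
  0 < d -> has_independent G s -> has_distance_subgraph R G s d.
Proof.
move=> d0 [A cA iA]; exists A => //.
pose f (x : {x | x \in A}) : 'rV[R]_d :=
  const_mx ((enum_rank (val x) : nat)%:R)%R.
have f_inj : injective f.
  move=> x y /rowP/(_ (Ordinal d0)); rewrite !mxE => /eqP.
  rewrite eqr_nat => /eqP/val_inj/enum_rank_inj; exact: val_inj.
pose V : set 'rV[R]_d := range f.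
have fV x : f x \in V by apply/mem_set; exists x.
pose g x : set_type V := exist _ (f x) (fV x).
have empty_sym : symmetric (fun _ _ : set_type V => false) by [].
have empty_irr : irreflexive (fun _ _ : set_type V => false) by [].
exists V, (SGraph empty_sym empty_irr); split=> //.
exists g; last first.
  by move=> [x xA] [y yA] /=; apply/esym/negbTE/iA.
have exV (z : set_type V) : exists x, g x = z.
  by case: z => z zV; have [x _ xz] := set_mem zV; exists x; apply: val_inj.
exists (fun z => sval (cid (exV z))).
  move=> x; case: cid => y /= /(congr1 val) /=; exact: f_inj.
by move=> z; case: cid.
Qed.

Lemma dist_ramseyP (R : realType) s t d : 0 < d ->
  dist_ramsey_prop R s t d (dist_ramsey R s t d) /\
  forall m, dist_ramsey_prop R s t d m -> dist_ramsey R s t d <= m.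
Proof.
move=> d0; apply: leastP; have [n Pn] := ramsey_exists s t; exists n => G.
by case: (Pn G) => h; [left|right]; apply: independent_distance.
Qed.

(* Main.v *)
Require Import Defs.
From mathcomp Require Import all_boot all_order all_algebra.
From mathcomp Require Import all_classical all_reals all_analysis.
From mathcomp Require Import ring zify.

(** Put k = [d/2], m = ceil(s/k) and r = R(m, m).  Two facts give the first
bound.

A k-colourable finite graph is a distance graph in dimension 2k
(colorable_distance_subgraph).  This is Lenz's construction: the k circles of
radius 1/sqrt 2 centred at the origin, in k mutually orthogonal coordinate
planes, have the property that any two points on different circles are at
distance sqrt(1/2 + 1/2) = 1.  Sending each colour class injectively into its
own circle realises every edge with length 1.

A graph on 2kr vertices contains, either in itself or in its complement, k
disjoint independent sets of size m: cut the vertices into 2k blocks of r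
vertices, find in each block an m-set independent in the graph or in its
complement, and keep the more frequent of the two kinds.  The union of these
k sets has km >= s vertices and is k-colourable, so any s of its vertices
induce a distance graph (dist_ramsey_le).

The asymptotic bound follows from the Erdos-Szekeres recursion in the form
R(s, t) <= 2^(s+t) (ramsey_le).  It gives
2k R(m, m) <= 4^k 4^m <= 4^(s/k + 1 + k), and the exponent is
(s/k) (1 + k (k + 1) / s), whose correction term tends to 0
(ramsey_bound_asymptotics). *)

Set Implicit Arguments.
Unset Strict Implicit.
Unset Printing Implicit Defensive.

Import Order.TTheory GRing.Theory Num.Theory.
Import numFieldNormedType.Exports.

Local Open Scope classical_set_scope.
Local Open Scope ring_scope.

(** * Upper bounds on Ramsey numbers *)

Lemma subset_of_card (T : finType) (B : {set T}) (n : nat) :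
  (n <= #|B|)%N -> exists2 A : {set T}, A \subset B & #|A| = n.
Proof.
move=> /card_geqP[s [us <- sB]]; exists [set x in s]%SET.
  by apply/fintype.subsetP => x; rewrite inE => /sB.
by rewrite cardsE; apply/card_uniqP.
Qed.

Lemma independentU1 (T : finType) (G : sgraph T) (v : T) (A : {set T}) :
  {in A, forall x, (x != v) && ~~ G v x} -> independent G A ->
  #|(v |: A)%SET| = #|A|.+1 /\ independent G (v |: A)%SET.
Proof.
move=> vA iA; split.
  by rewrite cardsU1; case: (boolP (v \in A)) => // /vA; rewrite eqxx.
move=> x y; rewrite !in_setU1 => /orP[/eqP->|xA] /orP[/eqP->|yA].
- by rewrite adj_irr.
- by have /andP[] := vA _ yA.
- by rewrite adj_sym; have /andP[] := vA _ xA.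
- exact: iA.
Qed.

(** The Erdos-Szekeres recursion, run inside a vertex set B.  Remove a vertex v:
the remaining vertices split into neighbours and non-neighbours of v, and
2^(s+1+t) + 2^(s+t+1) = 2^(s+1+t+1) forces one of the two parts to be large
enough for the induction.  Among the neighbours v extends independent sets of
the complement, among the non-neighbours independent sets of G. *)
Lemma ramsey_dichotomy (s t : nat) (T : finType) (G : sgraph T)
    (B : {set T}) : (2 ^ (s + t) <= #|B|)%N ->
  (exists A : {set T}, [/\ A \subset B, #|A| = s & independent G A]) \/
  (exists A : {set T}, [/\ A \subset B, #|A| = t &
     independent (graph_compl G) A]).
Proof.
elim: s t B => [|s IHs] t B leB.
  left; exists finset.set0; split; [exact: finset.sub0set | exact: cards0 |].
  by move=> x y; rewrite inE.
elim: t B leB => [|t IHt] B leB.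
  right; exists finset.set0; split; [exact: finset.sub0set | exact: cards0 |].
  by move=> x y; rewrite inE.
have /card_gt0P[v vB] : (0 < #|B|)%N by apply: leq_trans leB; rewrite expn_gt0.
pose C : {set T} := B :\ v; pose N : {set T} := [set x | G v x]%SET.
have cardB : #|B| = (#|C :&: N| + #|C :\: N|).+1%N.
  by rewrite cardsID (cardsD1 v B) vB.
have CB : C \subset B by rewrite subD1set.
have sub (D : {set T}) : D \subset C -> (v |: D)%SET \subset B.
  move=> DC; rewrite finset.subUset finset.sub1set vB.
  exact: fintype.subset_trans CB.
have [le2|lt2] := leqP (2 ^ (s.+1 + t)) #|C :&: N|.
  have sCB := fintype.subset_trans (finset.subsetIl C N) CB.
  have [[A [sA cA iA]]|[A [sA cA iA]]] := IHt _ le2.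
    by left; exists A; split=> //; apply: fintype.subset_trans sA sCB.
  have [|cvA ivA] := @independentU1 _ (graph_compl G) v A _ iA.
    by move=> x /(fintype.subsetP sA); rewrite !inE /= negb_and negbK
      => /andP[/andP[-> _] ->]; rewrite orbT.
  right; exists (v |: A)%SET; split; [|by rewrite cvA cA|by []].
  by apply: sub; apply: fintype.subset_trans sA _; exact: finset.subsetIl.
(* B has at least 2 ^ (s+1+t) + 2 ^ (s+t+1) elements; v is missing from the two
   parts, but the other part falls short of its threshold by at least one. *)
have le1 : (2 ^ (s + t.+1) <= #|C :\: N|)%N.
  have := leB; rewrite cardB addSn expnS mul2n -addnn -{2}addSnnS; lia.
have sCB := fintype.subset_trans (finset.subsetDl C N) CB.
have [[A [sA cA iA]]|[A [sA cA iA]]] := IHs _ _ le1; last first.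
  by right; exists A; split=> //; apply: fintype.subset_trans sA sCB.
have [|cvA ivA] := @independentU1 _ G v A _ iA.
  by move=> x /(fintype.subsetP sA); rewrite !inE => /andP[-> /andP[->]].
left; exists (v |: A)%SET; split; [|by rewrite cvA cA|by []].
by apply: sub; apply: fintype.subset_trans sA _; exact: finset.subsetDl.
Qed.

Lemma ramsey_le (s t : nat) : (ramsey s t <= 2 ^ (s + t))%N.
Proof.
have [_] := ramseyP s t; apply=> G.
have leT : (2 ^ (s + t) <= #|[set: 'I_(2 ^ (s + t))]%SET|)%N.
  by rewrite cardsT card_ord.
by have [[A [_ cA iA]]|[A [_ cA iA]]] := ramsey_dichotomy G leT;
  [left|right]; exists A.
Qed.

(** * Ramsey's theorem inside a set of vertices *)

Definition pullback_graph (T U : Type) (f : U -> T) (G : sgraph T) : sgraph U :=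
  @SGraph U (fun x y => G (f x) (f y)) (fun x y => adj_sym G (f x) (f y))
    (fun x => adj_irr G (f x)).

(** The defining property of the Ramsey number speaks of graphs on exactly
'I_(ramsey s t); numbering that many elements of B transports it to every
finite graph and every vertex set that is at least as large. *)
Lemma ramsey_within (s t : nat) (T : finType) (G : sgraph T) (B : {set T}) :
  (ramsey s t <= #|B|)%N ->
  (exists A : {set T}, [/\ A \subset B, #|A| = s & independent G A]) \/
  (exists A : {set T}, [/\ A \subset B, #|A| = t &
     independent (graph_compl G) A]).
Proof.
move=> leB; pose f (j : 'I_(ramsey s t)) : T := enum_val (widen_ord leB j).
have f_inj : injective f.
  by move=> i j /enum_val_inj /(congr1 val) /= /val_inj.
have fB (A : {set _}) : f @: A \subset B.
  by apply/fintype.subsetP => _ /imsetP[j _ ->]; apply: enum_valP.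
have [Pr _] := ramseyP s t.
have [[A cA iA]|[A cA iA]] := Pr (pullback_graph f G); [left|right];
  exists (f @: A); rewrite card_imset //; split=> //.
  by move=> _ _ /imsetP[x xA ->] /imsetP[y yA ->]; exact: iA.
move=> _ _ /imsetP[x xA ->] /imsetP[y yA ->].
by have := iA _ _ xA yA; rewrite /= (inj_eq f_inj).
Qed.

(** * Distance graphs from colourings *)

(** Reduces the existential over point sets, graphs on them and isomorphisms to
a single map from the vertices to the space.  The map is only constrained on
A, so it may take arbitrary values elsewhere. *)
Lemma distance_subgraph_of_embedding (R : realType) (T : finType)
    (G : sgraph T) (A : {set T}) (d : nat) (f : T -> 'rV[R]_d) :
  {in A &, injective f} ->
  {in A &, forall x y, G x y -> eucl_dist (f x) (f y) = 1} ->
  has_distance_subgraph R G #|A| d.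
Proof.
move=> f_inj f_dist; exists A => //.
pose V : set 'rV[R]_d := f @` [set` A].
have fV (x : {x | x \in A}) : f (val x) \in V.
  by apply/mem_set; exists (val x) => //; exact: valP.
pose g x : set_type V := exist _ (f (val x)) (fV x).
have exV (z : set_type V) : exists x, g x = z.
  case: z => z zV; have [x xA xz] := set_mem zV.
  by exists (exist _ x xA); apply: val_inj.
pose h z := sval (cid (exV z)).
have hK : cancel h g by move=> z; rewrite /h; case: cid.
have gK : cancel g h.
  move=> x; have /(congr1 val)/f_inj := hK (g x).
  by move=> /(_ (valP _) (valP _))/val_inj.
exists V, (pullback_graph h (Defs.induced G A)); split.
  move=> y z /= Gyz; rewrite -(hK y) -(hK z) /=.
  by apply: f_dist => //; exact: valP.
by exists g; [exists h | move=> x y /=; rewrite !gK].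
Qed.

Section CirclePoint.
Variables (R : realType) (d : nat).

(** Any injective family of abscissae u with u ^ 2 <= 1/2 would do. *)
Definition abscissa (n : nat) : R := n.+2%:R^-1.

(** The circles of radius 1/sqrt 2 in orthogonal planes: c selects the plane,
spanned by the coordinates 2c and 2c+1, and n selects a point on the upper
half of its circle. *)
Definition circle_point (c n : nat) : 'rV[R]_d :=
  \row_(i < d) (if (i : nat) == c.*2 then abscissa n
                else if (i : nat) == c.*2.+1 then Num.sqrt (2^-1 - abscissa n ^+ 2)
                else 0).

Lemma circle_point_norm (c n : nat) : (c.*2.+1 < d)%N ->
  \sum_(i < d) circle_point c n ord0 i ^+ 2 = 2^-1.
Proof.
move=> cd; pose i0 := Ordinal (ltnW cd); pose i1 := Ordinal cd.
rewrite (bigD1 i0) // (bigD1 i1) /=; last by rewrite -val_eqE /= neq_ltn ltnSn orbT.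
rewrite big1 => [|i /andP[]]; last first.
  by rewrite -!val_eqE /= !mxE => /negPf-> /negPf->; rewrite expr0n.
rewrite !mxE /= !eqxx -[_.+1 == _]negbK neq_ltn ltnSn orbT /= sqr_sqrtr; first by ring.
rewrite subr_ge0 exprVn lef_pV2 ?posrE ?exprn_gt0 ?ltr0n //.
by rewrite -natrX ler_nat expnS expn1; lia.
Qed.

(** Points in orthogonal planes have disjoint supports, so the squared distance
is the sum of the two squared norms, by Pythagoras. *)
Lemma circle_point_dist (c c' n n' : nat) :
  (c.*2.+1 < d)%N -> (c'.*2.+1 < d)%N -> c != c' ->
  eucl_dist (circle_point c n) (circle_point c' n') = 1.
Proof.
move=> cd cd' neq; rewrite /eucl_dist.
rewrite (eq_bigr (fun i => circle_point c n ord0 i ^+ 2 +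
                           circle_point c' n' ord0 i ^+ 2)) => [|i _].
  by rewrite big_split /= !circle_point_norm // -[RHS]sqrtr1; congr Num.sqrt; field.
suff /eqP : circle_point c n ord0 i * circle_point c' n' ord0 i = 0.
  by rewrite sqrrB => /eqP->; rewrite mul0rn subr0.
rewrite !mxE; do 4?case: eqP => //; rewrite ?mulr0 ?mul0r //; move/eqP: neq; lia.
Qed.

Lemma circle_point_inj (c n n' : nat) : (c.*2.+1 < d)%N ->
  circle_point c n = circle_point c n' -> n = n'.
Proof.
move=> cd /rowP/(_ (Ordinal (ltnW cd))); rewrite !mxE /= eqxx.
by move=> /invr_inj/eqP; rewrite eqr_nat => /eqP[].
Qed.

End CirclePoint.

(** Each colour gets a circle; inside a colour class there are no edges to
realise, so the only requirement there is injectivity, obtained by numbering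
the vertices. *)
Lemma colorable_distance_subgraph (R : realType) (T : finType) (G : sgraph T)
    (A : {set T}) (k d : nat) (c : T -> nat) : (2 * k <= d)%N ->
  {in A, forall x, (c x < k)%N} ->
  {in A &, forall x y, G x y -> c x != c y} ->
  has_distance_subgraph R G #|A| d.
Proof.
move=> kd ck c_proper.
have cd x : x \in A -> ((c x).*2.+1 < d)%N.
  by move=> /ck; rewrite -mul2n; lia.
apply: (@distance_subgraph_of_embedding _ _ _ _ _
          (fun x => circle_point R d (c x) (enum_rank x))).
  move=> x y xA yA; have [<-|neq] := eqVneq (c x) (c y).
    by move=> /(circle_point_inj (cd _ xA))/val_inj/enum_rank_inj.
  (* Two vertices of different colours sent to the same point would be at
     distance 0 and 1. *)
  move=> eq_xy; have := circle_point_dist R (enum_rank x) (enum_rank y)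
    (cd _ xA) (cd _ yA) neq.
  rewrite eq_xy /eucl_dist big1 => [|i _]; last by rewrite subrr expr0n.
  by rewrite sqrtr0 => /esym/eqP; rewrite oner_eq0.
move=> x y xA yA /(c_proper _ _ xA yA); apply: circle_point_dist; exact: cd.
Qed.

(** The fibres of c serve both to keep the independent sets disjoint, which makes
their union large, and to colour that union.  The index set P is cut down to
exactly k elements, since more colours would not fit in dimension d. *)
Lemma independent_family_distance_subgraph (R : realType) (T I : finType)
    (G : sgraph T) (c : T -> I) (P : {set I}) (k m s d : nat) :
  (2 * k <= d)%N -> (s <= k * m)%N -> (k <= #|P|)%N ->
  {in P, forall i, exists B : {set T},
     [/\ B \subset [set x | c x == i]%SET, #|B| = m & independent G B]} ->
  has_distance_subgraph R G s d.
Proof.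
move=> kd sm /subset_of_card[Q QP cQ] exB.
have /choice[B HB] : forall i, exists B : {set T}, i \in Q ->
    [/\ B \subset [set x | c x == i]%SET, #|B| = m & independent G B].
  move=> i; have [iQ|_] := boolP (i \in Q); last by exists finset.set0.
  by have [B HB] := exB i (fintype.subsetP QP _ iQ); exists B.
pose U : {set T} := [set x | (c x \in Q) && (x \in B (c x))]%SET.
have cU : #|U| = (k * m)%N.
  rewrite -sum1_card (partition_big c (mem Q)) /=; last first.
    by move=> x; rewrite inE => /andP[].
  rewrite -cQ -sum_nat_const; apply: eq_bigr => i iQ.
  have [sB <- _] := HB i iQ; rewrite -sum1_card; apply: eq_bigl => x.
  rewrite inE; apply/andP/idP => [[/andP[_ xB] /eqP <-] //|xB].
  by have := fintype.subsetP sB _ xB; rewrite inE => /eqP->; rewrite iQ xB eqxx.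
have [A AU <-] : exists2 A : {set T}, A \subset U & #|A| = s.
  by apply: subset_of_card; rewrite cU.
(* The colour of x is the rank of its fibre among the k selected ones. *)
apply: (@colorable_distance_subgraph _ _ _ _ k _ (fun x => index (c x) (enum Q))).
- by [].
- move=> x /(fintype.subsetP AU); rewrite inE => /andP[xQ _].
  by rewrite -cQ cardE index_mem mem_enum.
- move=> x y /(fintype.subsetP AU); rewrite inE => /andP[xQ xB].
  move=> /(fintype.subsetP AU); rewrite inE => /andP[yQ yB] Gxy.
  apply/eqP => /index_inj; rewrite !mem_enum => /(_ (c x) xQ yQ) exy.
  have [_ _ iB] := HB _ xQ; have := iB x y xB.
  by rewrite Gxy {1}exy => /(_ yB).
Qed.

(** * The two bounds *)

Lemma dist_ramsey_le (R : realType) (s d k m : nat) :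
  (0 < k)%N -> (2 * k <= d)%N -> (s <= k * m)%N ->
  (dist_ramsey R s s d <= 2 * k * ramsey m m)%N.
Proof.
move=> k0 kd sm; have [|_] := @dist_ramseyP R s s d; first by lia.
apply=> G; set r := ramsey m m.
(* 'I_(2 * k * r) is identified with 'I_(2 * k) * 'I_r, and c is the block. *)
have [p pK _] := curry_mxvec_bij (2 * k) r.
pose c x := (p x).1.
have class_card i : (r <= #|[set x | c x == i]%SET|)%N.
  have inj : injective (@mxvec_index (2 * k) r i).
    by move=> j l e; have := pK (i, j) isT; rewrite /= e (pK (i, l)) // => -[].
  rewrite -{1}(card_ord r) -cardsT -(card_imset _ inj); apply: subset_leq_card.
  apply/fintype.subsetP => _ /imsetP[j _ ->].
  by rewrite inE /c (pK (i, j)).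
(* P collects the blocks with a large independent set of G; the others have one
   of the complement, and P or its complement contains k of the 2k blocks. *)
pose hom H i := exists B : {set 'I_(2 * k * r)},
  [/\ B \subset [set x | c x == i]%SET, #|B| = m & independent H B].
pose P : {set 'I_(2 * k)} := [set i | `[< hom G i >]]%SET.
have [leP|ltP] := leqP k #|P|; [left|right].
  apply: (@independent_family_distance_subgraph _ _ _ _ c P k m) => // i.
  by rewrite inE => /asboolP.
have leP : (k <= #|~: P|)%N by rewrite cardsCs finset.setCK card_ord; lia.
apply: (@independent_family_distance_subgraph _ _ _ _ c (~: P)%SET k m) => // i.
by rewrite !inE => /asboolPn nG; have [/nG|] := ramsey_within G (class_card i).
Qed.

Lemma ceil_div_bounds (s k : nat) : (0 < k)%N ->
  (s <= k * ceil_div s k < s + k)%N.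
Proof.
move=> k0; rewrite /ceil_div; set q : rat := s%:R / k%:R.
have k0' : 0 < k%:R :> rat by rewrite ltr0n.
have q0 : 0 <= q by rewrite divr_ge0 ?ler0n.
have := ceil_itv q.
have : 0 <= Num.ceil q by rewrite ceil_ge0 (lt_le_trans _ q0).
case: (Num.ceil q) => // n _ /=; rewrite intrD /= -pmulrn => /andP[lt ge].
have qk : q * k%:R = s%:R by rewrite /q divfK // gt_eqF.
apply/andP; split.
  by rewrite -(ler_nat rat) natrM mulrC -qk ler_pM2r.
rewrite -(ltr_nat rat) natrD natrM -qk mulrC -ltrBlDr.
by rewrite -[X in _ - X]mul1r -mulrBl ltr_pM2r.
Qed.

(** With C = k (k + 1), the error term C / s is chosen so that
(s/k) (1 + C / s) = s/k + k + 1 exactly: the summand k pays for the factor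
2k <= 4^k, the summand 1 for the rounding in ceil(s/k) < s/k + 1. *)
Lemma ramsey_bound_asymptotics (R : realType) (k : nat) : (0 < k)%N ->
  exists2 eps : nat -> R, eps @ \oo --> (0 : R) &
    \forall s \near \oo,
      (2 * k * ramsey (ceil_div s k) (ceil_div s k))%N%:R
      <= 4 `^ (s%:R / k%:R * (1 + eps s)) :> R.
Proof.
move=> k0; pose C : R := k%:R * (k%:R + 1).
exists (fun s => C * s%:R^-1).
  rewrite -(mulr0 C); apply: cvgMr.
  by rewrite -cvg_shiftS; exact: cvg_harmonic.
exists 1%N => // s /= s0; set m := ceil_div s k.
have /andP[_ mk] := ceil_div_bounds s k0.
have k0' : 0 < k%:R :> R by rewrite ltr0n.
have s0' : 0 < s%:R :> R by rewrite ltr0n.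
have le4 : (2 * k * ramsey m m <= 4 ^ (k + m))%N.
  rewrite expnD leq_mul //; last first.
    by rewrite (leq_trans (ramsey_le m m)) // addnn -mul2n expnM.
  have lt2k : (k < 2 ^ k)%N by exact: ltn_expl.
  by rewrite -[4%N]/(2 * 2)%N expnMn leq_mul ?(ltnW lt2k) ?(leq_trans _ lt2k).
apply: (@le_trans _ _ (4 `^ (k + m)%:R)).
  by rewrite powR_mulrn // -natrX ler_nat.
apply: ler_powR; first by rewrite ler1n.
have -> : s%:R / k%:R * (1 + C * s%:R^-1) = s%:R / k%:R + k%:R + 1 :> R.
  by rewrite /C; field; rewrite !gt_eqF.
rewrite natrD addrC -addrA [k%:R + 1]addrC addrA lerD2r -(ler_pM2r k0').
rewrite mulrDl divfK ?gt_eqF // mul1r -natrM -natrD ler_nat mulnC ltnW //.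
Qed.

Theorem proposition1 (R : realType) :
  (forall d s : nat, (2 <= d <= s)%N ->
     (dist_ramsey R s s d <=
        2 * (d %/ 2) *
        ramsey (ceil_div s (d %/ 2)) (ceil_div s (d %/ 2)))%N)
  /\
  (forall d : nat, (2 <= d)%N ->
     exists2 eps : nat -> R, eps @ \oo --> (0 : R) &
       \forall s \near \oo,
         (2 * (d %/ 2) *
            ramsey (ceil_div s (d %/ 2)) (ceil_div s (d %/ 2)))%N%:R
         <= 4 `^ (s%:R / (d %/ 2)%N%:R * (1 + eps s)) :> R).
Proof.
split=> [d s /andP[d2 _]|d d2].
  have k0 : (0 < d %/ 2)%N by rewrite divn_gt0.
  apply: dist_ramsey_le => //; first by rewrite mulnC leq_trunc_div.
  by have /andP[] := ceil_div_bounds s k0.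
by apply: ramsey_bound_asymptotics; rewrite divn_gt0.
Qed.
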